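(* Let $\mathcal{A}$ be an integral domain containing a field $k$ of characteristic zero, and let $D$ be a $k$-derivation on $\mathcal{A}$. If $\mathcal{A}$ is a local ring and $D$ is locally finite, then $D=0$.
   Context: A $k$-derivation on a commutative $k$-algebra $\mathcal{A}$ is a $k$-linear map $D:\mathcal{A}\to\mathcal{A}$ with $D(ab)=D(a)b+aD(b)$ for all $a,b\in\mathcal{A}$. It is locally finite if for each $a\in\mathcal{A}$ the $k$-subspace spanned by the elements $D^m(a)$ ($m\ge 0$) is finite dimensional over $k$. *)

(* Defs.v *)
From HB Require Import structures.
From mathcomp Require Import all_boot all_algebra.

Set Implicit Arguments.
Unset Strict Implicit.
Unset Printing Implicit Defensive.

Import GRing.Theory.
Local Open Scope ring_scope.

(* [idealr_closed] already requires 1 \notin I, so ideals here are proper.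
   They are boolean predicates; in classical logic these are all subsets. *)
Definition maximal_ideal (A : comNzRingType) (M : {pred A}) : Prop :=
  idealr_closed M /\
  forall I : {pred A}, idealr_closed I -> {subset M <= I} -> I =i M.

Definition local_ring (A : comNzRingType) : Prop :=
  exists M : {pred A},
    maximal_ideal M /\ forall N : {pred A}, maximal_ideal N -> N =i M.

Section Subspaces.
Variables (k : fieldType) (V : lmodType k).

(* [{vspace V}] and [<<_>>%VS] are only available when V itself is
   finite dimensional, so subspaces are predicates on V here. *)
Definition lin_span (S : V -> Prop) (x : V) : Prop :=
  exists (n : nat) (v : 'I_n -> V) (c : 'I_n -> k),
    (forall i, S (v i)) /\ x = \sum_(i < n) c i *: v i.

Definition lin_independent (n : nat) (b : 'I_n -> V) : Prop :=
  forall c : 'I_n -> k, \sum_(i < n) c i *: b i = 0 -> forall i, c i = 0.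

Definition finite_dimensional (W : V -> Prop) : Prop :=
  exists (n : nat) (b : 'I_n -> V),
    lin_independent b /\
    forall x, W x <-> exists c : 'I_n -> k, x = \sum_(i < n) c i *: b i.

End Subspaces.

Section Derivations.
Variables (k : fieldType) (A : comAlgType k).

Definition is_derivation (D : {linear A -> A}) : Prop :=
  forall a b : A, D (a * b) = D a * b + a * D b.

Definition locally_finite (D : {linear A -> A}) : Prop :=
  forall a : A,
    finite_dimensional (lin_span (fun x : A => exists m : nat, x = iter m D a)).

End Derivations.

(* Main.v *)
Require Import Defs.
From HB Require Import structures.
From mathcomp Require Import all_boot all_algebra.
From mathcomp Require Import boolp classical_sets.
From mathcomp Require Import ring zify.

Set Implicit Arguments.
Unset Strict Implicit.
Unset Printing Implicit Defensive.

Import GRing.Theory.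
Local Open Scope ring_scope.

(** The idea is that inverses in [A] see the whole orbit of [D].  Suppose
    [D a <> 0].  Since [A] is local, [u := a - c] is a unit for every scalar
    [c] but at most one.  Let [v] be the inverse of such a [u].  Differentiating
    [u * v = 1] repeatedly gives
      [u^(n+1) D^n(v) = (-1)^n n! (D u)^n + u r],
    where [r] is a polynomial in the iterates of [D] on [a].  By local
    finiteness some [D^N(v)] is a combination of the lower iterates of [v], and
    multiplying that relation by [u^(N+1)] shows, in characteristic zero, that
    [u = a - c] divides [(D a)^N] ([unit_divides_power_derivative]).  The
    division takes place in a ring [S = k[a][b_1]...[b_n]] that does not depend
    on [c]: by local finiteness of [D] at [a], the span of its orbit has a
    finite basis [b_1, ..., b_n], and [S] is stable under [D]
    ([finite_orbit_stable_subring]).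

    So one nonzero element [D a] of a finitely generated domain over [k[a]] is
    divisible, up to taking powers, by [a - c] for infinitely many [c].  An
    elementary form of the Nullstellensatz forbids this: divisibility of a power
    of a nonzero element descends along finitely generated extensions of domains
    ([descend_adjoin_seq]).  Hence some nonzero [g] in [k[a]] has powers
    divisible by [a - c] within [k[a]], for all those [c].  In characteristic
    zero, [D a <> 0] forces [a] to be transcendental ([derivation_algebraic]),
    so [k[a]] is a polynomial ring in which [g] has infinitely many roots:
    a contradiction. *)

(** * Nonunits of local rings *)

Section Local.
Variable A : comNzRingType.

(** Zorn's lemma is about sets, while ideals are boolean predicates. *)
Lemma idealr_closed_setP (I : set A) :
  idealr_closed (fun y => `[< I y >]) <->
  [/\ I 0, ~ I 1 & forall a u v, I u -> I v -> I (a * u + v)].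
Proof.
split=> -[I0 I1 Ilin]; split.
- exact/asboolP.
- by move=> H; move/negP: I1; apply; apply/asboolP.
- by move=> a u v Iu Iv; apply/asboolP/Ilin; apply/asboolP.
- exact/asboolP.
- by apply/negP => /asboolP.
- by move=> a u v /asboolP Iu /asboolP Iv; apply/asboolP/Ilin.
Qed.

(** Zorn's lemma on the proper ideals containing [x]; there is one, namely the
    principal ideal of [x]. *)
Lemma nonunit_in_maximal_ideal (x : A) :
  (forall y, x * y != 1) -> exists M : {pred A}, maximal_ideal M /\ x \in M.
Proof.
move=> x_nonunit.
pose ideal_with_x (I : set A) := idealr_closed (fun y => `[< I y >]) /\ I x.
(* The chain may be empty, so the empty set has to be admitted as well. *)
have [|N [PN Nmax]] := @Zorn_bigcup A (fun I => I = set0 \/ ideal_with_x I).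
  move=> F FP Ftot.
  have [[I FI [/idealr_closed_setP[I0 _ _] Ix]]|noI] :=
      EM (exists2 I, F I & ideal_with_x I); last first.
    left; apply/seteqP; split=> // y [I FI Iy].
    case: (FP I FI) => [I0|IP]; first by rewrite I0 in Iy.
    by case: noI; exists I.
  have Fideal J y : F J -> J y -> idealr_closed (fun y => `[< J y >]).
    by case/FP => [->|[]].
  right; split; last by exists I.
  apply/idealr_closed_setP; split; first by exists I.
    by move=> [J FJ J1]; have /idealr_closed_setP[_ /(_ J1)] := Fideal J 1 FJ J1.
  move=> c y z [J FJ Jy] [K FK Kz].
  have step L : F L -> L y -> L z -> (\bigcup_(X in F) X)%classic (c * y + z).
    move=> FL Ly Lz; exists L => //.
    by have /idealr_closed_setP[_ _] := Fideal L y FL Ly; apply.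
  case: (Ftot J K FJ FK) => sub.
    by apply: (step K) => //; apply: sub.
  by apply: (step J) => //; apply: sub.
pose xA : set A := [set y | exists z, y = x * z]%classic.
have PxA : ideal_with_x xA.
  split; last by exists 1; rewrite mulr1.
  apply/idealr_closed_setP; split; first by exists 0; rewrite mulr0.
    by move=> [z /esym/eqP]; apply/negP.
  by move=> c y z [s ->] [t ->]; exists (c * s + t); ring.
have {PN} [Nideal Nx] : ideal_with_x N.
  case: PN => // N0; exfalso; apply: (Nmax xA); last by right.
  rewrite N0; split; first by move=> ? [].
  by move=> /(_ x); apply; case: PxA.
exists (fun y => `[< N y >]); split; last exact/asboolP.
split=> // I Iideal NI y.
have [IN|IN] := EM (forall z, z \in I -> N z).
  by apply/idP/idP => [/IN Ny|]; [apply/asboolP | apply: NI].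
have NI' z : N z -> z \in I by move=> Nz; apply: NI; apply/asboolP.
case: (Nmax [set` I]%classic); first by split.
right; split; last exact: NI'.
suff -> : (fun y => `[< [set` I]%classic y >]) = I by [].
by apply/funext => z; rewrite /= asboolb.
Qed.

(** Every nonunit lies in the unique maximal ideal, which is closed under
    subtraction. *)
Lemma local_ring_nonunit_sub (x y : A) : local_ring A ->
  (forall z, x * z != 1) -> (forall z, y * z != 1) ->
  forall z, (x - y) * z != 1.
Proof.
move=> [M [[[M0 M1 Mlin] _] Muniq]] x_nonunit y_nonunit z.
have inM t : (forall w, t * w != 1) -> t \in M.
  by move=> /nonunit_in_maximal_ideal[N [/Muniq <-]].
apply: contraNneq M1 => <-.
have -> : (x - y) * z = z * x + ((- z) * y + 0) by ring.
by rewrite !Mlin // inM.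
Qed.

End Local.

(** * Subrings generated by finitely many elements *)

Section Adjunction.
Variable A : comNzRingType.

Definition adjoin (B : {pred A}) (w : A) : {pred A} :=
  fun x => `[< exists2 p : {poly A}, p \is a polyOver B & x = p.[w] >].

Lemma adjoinP (B : {pred A}) w x :
  reflect (exists2 p : {poly A}, p \is a polyOver B & x = p.[w])
    (x \in adjoin B w).
Proof. by rewrite unfold_in; apply: asboolP. Qed.

Section Subring.
Variables (B : subringClosed A) (w : A).

Lemma adjoin_subring_closed : GRing.subring_closed (adjoin B w).
Proof.
split.
- by apply/adjoinP; exists 1; rewrite ?rpred1 ?hornerC.
- move=> x y /adjoinP[p pB ->] /adjoinP[q qB ->]; apply/adjoinP.
  by exists (p - q); rewrite ?rpredB // hornerD hornerN.
- move=> x y /adjoinP[p pB ->] /adjoinP[q qB ->]; apply/adjoinP.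
  by exists (p * q); rewrite ?rpredM // hornerM.
Qed.

HB.instance Definition _ :=
  GRing.isSubringClosed.Build A (adjoin B w) adjoin_subring_closed.

Lemma sub_adjoin : {subset B <= adjoin B w}.
Proof.
by move=> x xB; apply/adjoinP; exists x%:P; rewrite ?polyOverC ?hornerC.
Qed.

Lemma adjoin_gen : w \in adjoin B w.
Proof. by apply/adjoinP; exists 'X; rewrite ?polyOverX ?hornerX. Qed.

Lemma adjoin_least (E : subringClosed A) :
  {subset B <= E} -> w \in E -> {subset adjoin B w <= E}.
Proof.
move=> BE wE x /adjoinP[p pB ->].
by rewrite rpred_horner //; apply: (polyOverS BE).
Qed.

End Subring.

Definition adjoin_seq (B : subringClosed A) (s : seq A) : subringClosed A :=
  foldr (fun w (C : subringClosed A) => adjoin C w) B s.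

Lemma sub_adjoin_seq (B : subringClosed A) s : {subset B <= adjoin_seq B s}.
Proof. by elim: s => [|w s IHs] x xB //=; apply/sub_adjoin/IHs. Qed.

Lemma adjoin_seq_gen (B : subringClosed A) s : {subset s <= adjoin_seq B s}.
Proof.
elim: s => [|w s IHs] x //=; rewrite inE => /predU1P[->|/IHs xs].
  exact: adjoin_gen.
exact: sub_adjoin.
Qed.

Lemma adjoin_seq_least (B : subringClosed A) s (E : subringClosed A) :
  {subset B <= E} -> {subset s <= E} -> {subset adjoin_seq B s <= E}.
Proof.
elim: s => [|w s IHs] //= BE sE; apply: adjoin_least.
  by apply: IHs => // x xs; apply: sE; rewrite inE xs orbT.
by apply: sE; rewrite inE eqxx.
Qed.

(** * Descent of divisibility along finitely generated extensions *)

Definition divides_power_in (S : {pred A}) (x b : A) :=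
  exists N, exists2 y, y \in S & b ^+ N = x * y.

(** For [B = k[t]] a polynomial ring and [x = t - c], this implies that a
    nonzero element of [C] vanishes identically over only finitely many points
    [t = c] of the line; it plays the role of the Nullstellensatz.  Being about
    divisibility, with [b] an arbitrary nonzero element, it composes along
    towers. *)
Definition power_divisors_descend (B C : {pred A}) :=
  forall b, b \in C -> b != 0 -> exists g, [/\ g \in B, g != 0 &
    forall x, x \in B -> divides_power_in C x b -> divides_power_in B x g].

Lemma power_divisors_descend_trans (B C E : {pred A}) : {subset B <= C} ->
  power_divisors_descend B C -> power_divisors_descend C E ->
  power_divisors_descend B E.
Proof.
move=> BC dBC dCE b bE b0; have [c [cC c0 cP]] := dCE b bE b0.
have [g [gB g0 gP]] := dBC c cC c0; exists g; split=> // x xB xb.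
exact/gP/cP/xb/BC.
Qed.

Hypothesis domA : GRing.integral_domain_axiom A.

Lemma dom_mulf_eq0 (x y : A) : (x * y == 0) = (x == 0) || (y == 0).
Proof.
apply/eqP/idP => [|/orP[]/eqP->]; first exact: domA.
  by rewrite mul0r.
by rewrite mulr0.
Qed.

Lemma dom_expf_neq0 (x : A) n : x != 0 -> x ^+ n != 0.
Proof.
move=> x0; elim: n => [|n IHn]; first by rewrite expr0 oner_neq0.
by rewrite exprS dom_mulf_eq0 negb_or x0.
Qed.

Lemma dom_lead_coefX (p : {poly A}) n :
  p != 0 -> lead_coef (p ^+ n) = lead_coef p ^+ n.
Proof.
move=> p0; elim: n => [|n IHn]; first by rewrite !expr0 lead_coef1.
rewrite !exprS lead_coef_proper_mul IHn //.
by rewrite -exprS dom_expf_neq0 ?lead_coef_eq0.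
Qed.

Section OneElement.
Variables (B : subringClosed A) (w : A).

(** Scaling [p] by powers of the leading coefficient of [q] replaces inverting
    it, which keeps the quotient and the remainder over [B]. *)
Lemma pseudo_division (q : {poly A}) : q \is a polyOver B -> q != 0 ->
  forall p, p \is a polyOver B -> exists s t r,
    [/\ t \is a polyOver B, r \is a polyOver B, (size r < size q)%N
      & lead_coef q ^+ s *: p = t * q + r].
Proof.
move=> qB q0 p; have [n] := ubnP (size p); elim: n p => // n IHn p pn pB.
have [pq|qp] := ltnP (size p) (size q).
  by exists 0%N, 0, p; rewrite rpred0 expr0 scale1r mul0r add0r.
have lqB : lead_coef q \in B by rewrite lead_coefE; apply/polyOverP.
have lpB : lead_coef p \in B by rewrite lead_coefE; apply/polyOverP.
set m := (size p - size q)%N.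
have q_gt0 : (0 < size q)%N by rewrite size_poly_gt0.
have p_gt0 := leq_trans q_gt0 qp.
have tB : lead_coef p *: 'X^m \is a polyOver B.
  by rewrite polyOverZ ?polyOverXn.
pose p' := lead_coef q *: p - lead_coef p *: 'X^m * q.
have p'B : p' \is a polyOver B by rewrite rpredB ?rpredM // polyOverZ.
have p'n : (size p' < n)%N.
  apply: leq_trans (_ : size p <= n)%N; last by rewrite -ltnS.
  rewrite -(prednK p_gt0) ltnS; apply/leq_sizeP => j pj.
  rewrite coefB coefZ -scalerAl coefZ coefXnM.
  have -> : (j < m)%N = false.
    by apply/negbTE; rewrite -leqNgt (leq_trans _ pj) // /m; lia.
  have [->|j_neq] := eqVneq j (size p).-1; last first.
    have pj' : (size p <= j)%N by lia.
    have qj : (size q <= j - m)%N by rewrite /m; lia.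
    by rewrite (nth_default 0 pj') (nth_default 0 qj) !mulr0 subr0.
  have -> : ((size p).-1 - m = (size q).-1)%N by rewrite /m; lia.
  by rewrite -!lead_coefE mulrC subrr.
have [s [t [r [tB' rB rq E]]]] := IHn p' p'n p'B.
exists s.+1, (t + lead_coef q ^+ s *: (lead_coef p *: 'X^m)), r; split=> //.
  by rewrite rpredD // polyOverZ ?rpredX.
have -> : lead_coef q ^+ s.+1 *: p =
    lead_coef q ^+ s *: p' + lead_coef q ^+ s *: (lead_coef p *: 'X^m * q).
  by rewrite -scalerDr subrK scalerA exprSr.
by rewrite E mulrDl -!scalerAl addrAC.
Qed.

(** In a polynomial ring [B[w]], an element of [B] dividing a power of [p.[w]]
    divides all the coefficients of that power, in particular the leading one. *)
Lemma descend_transcendental :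
  (forall p, p \is a polyOver B -> p.[w] = 0 -> p = 0) ->
  power_divisors_descend B (adjoin B w).
Proof.
move=> w_trans b /adjoinP[p pB ->] pw0.
have p0 : p != 0 by apply: contraNneq pw0 => ->; rewrite horner0.
exists (lead_coef p); split; last 1 first.
- move=> x xB [N [_ /adjoinP[q qB ->] E]]; exists N.
  have {}E : p ^+ N = x *: q.
    apply/subr0_eq/w_trans; first by rewrite rpredB ?rpredX // polyOverZ.
    by rewrite hornerD hornerN hornerZ horner_exp E subrr.
  exists (q`_(size (p ^+ N)).-1); first exact/polyOverP.
  by rewrite -dom_lead_coefX // lead_coefE E coefZ.
- by rewrite lead_coefE; apply/polyOverP.
- by rewrite lead_coef_eq0.
Qed.

Section Algebraic.
(** [q] is a minimal polynomial of [w] over the fraction field of [B], with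
    denominators cleared. *)
Variable q : {poly A}.
Hypotheses (qB : q \is a polyOver B) (q0 : q != 0) (qw : q.[w] = 0).
Hypothesis q_min : forall p, p \is a polyOver B -> p.[w] = 0 ->
  (size p < size q)%N -> p = 0.

Lemma size_min_annihilator : (1 < size q)%N.
Proof.
rewrite ltnNge; apply/negP => /size1_polyC qE.
by move: q0 qw; rewrite qE hornerC => /[swap] ->; rewrite eqxx.
Qed.

(** A nonzero element of [B[w]] is algebraic over [B], so it divides a nonzero
    constant.  The constant comes from a Euclidean descent: a remainder modulo
    [r] of a multiple of [q] takes at [w] a value that is a multiple of [r.[w]].
    The descent only stops at a constant, because a remainder vanishing at [w]
    would split [q] into factors, one of which contradicts its minimality. *)
Lemma nonzero_constant_multiple (r : {poly A}) :
  r \is a polyOver B -> r.[w] != 0 ->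
  exists2 d, d \in B & d != 0 /\ exists2 z, z \in adjoin B w & d = r.[w] * z.
Proof.
have [n] := ubnP (size r); elim: n r => // n IHn r rn rB rw.
have r0 : r != 0 by apply: contraNneq rw => ->; rewrite horner0.
have lqB : lead_coef q \in B by rewrite lead_coefE; apply/polyOverP.
have lrB : lead_coef r \in B by rewrite lead_coefE; apply/polyOverP.
have evalB p : p \is a polyOver B -> p.[w] \in adjoin B w.
  by move=> pB; apply/adjoinP; exists p.
have [qr|rq] := leqP (size q) (size r).
  have [s [t [r' [tB r'B r'q E]]]] := pseudo_division qB q0 rB.
  have Ew : lead_coef q ^+ s * r.[w] = r'.[w].
    by rewrite -hornerZ E hornerD hornerM qw mulr0 add0r.
  have [||d dB [d0 [z zB dE]]] := IHn r' _ r'B.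
  - by rewrite -ltnS (leq_trans _ rn) // ltnS (leq_trans r'q).
  - by rewrite -Ew dom_mulf_eq0 negb_or rw dom_expf_neq0 ?lead_coef_eq0.
  exists d => //; split=> //; exists (lead_coef q ^+ s * z).
    by rewrite rpredM // rpredX // sub_adjoin.
  by rewrite dE -Ew mulrCA mulrA.
have [r1|r_gt1] := leqP (size r) 1.
  have rE := size1_polyC r1; exists r.[w].
    by rewrite rE hornerC; apply/polyOverP.
  by split=> //; exists 1; rewrite ?rpred1 ?mulr1.
have [s [t [r' [tB r'B r'r E]]]] := pseudo_division rB r0 qB.
have Ew : r'.[w] = - t.[w] * r.[w].
  apply/eqP; rewrite mulNr -addr_eq0 addrC -hornerM -hornerD -E hornerZ qw.
  by rewrite mulr0.
have [r'w|r'w] := eqVneq r'.[w] 0; last first.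
  have [|d dB [d0 [z zB dE]]] := IHn r' _ r'B r'w.
    by rewrite -ltnS (leq_trans _ rn).
  exists d => //; split=> //; exists (- t.[w] * z).
    by rewrite rpredM // rpredN evalB.
  by rewrite dE Ew mulrAC mulrC.
exfalso; have r'0 : r' = 0 by apply: q_min; rewrite // (ltn_trans r'r).
have t0 : t != 0.
  apply/eqP => t0; move/(congr1 (fun p : {poly A} => p`_(size q).-1)): E.
  rewrite t0 r'0 mul0r addr0 coefZ coef0 -lead_coefE => /eqP.
  rewrite dom_mulf_eq0 lead_coef_eq0 (negPf q0) orbF; apply/negP.
  by rewrite dom_expf_neq0 ?lead_coef_eq0.
have tw : t.[w] = 0.
  move/eqP: Ew; rewrite r'w eq_sym dom_mulf_eq0 (negPf rw) orbF oppr_eq0.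
  by move/eqP.
move/eqP: (t0); apply; apply: q_min => //.
have trq : (size (t * r)%R <= size q)%N.
  by move: E; rewrite r'0 addr0 => <-; apply: size_scale_leq.
have := trq; rewrite size_proper_mul; last first.
  by rewrite dom_mulf_eq0 !lead_coef_eq0 negb_or r0 t0.
move: r_gt1; lia.
Qed.

(** Take a nonzero [d] in [B] divisible by [b].  A divisor [x] of a power of
    [b] divides [d^N] in [B[w]].  After multiplication by a power of the leading
    coefficient of [q] the cofactor is a polynomial in [w] of degree below that
    of [q].  Powers of [w] below this degree are linearly independent over [B],
    so the constant coefficients give a divisibility in [B]. *)
Lemma descend_algebraic : power_divisors_descend B (adjoin B w).
Proof.
move=> b /adjoinP[p pB ->] pw0.
have [d dB [d0 [z zC dE]]] := nonzero_constant_multiple pB pw0.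
have lqB : lead_coef q \in B by rewrite lead_coefE; apply/polyOverP.
exists (lead_coef q * d); split; first by rewrite rpredM.
  by rewrite dom_mulf_eq0 negb_or lead_coef_eq0 q0.
move=> x xB [N [y yC E]].
have /adjoinP[p2 p2B p2E] : y * z ^+ N \in adjoin B w by rewrite rpredM ?rpredX.
have [s [t [r [tB rB rq Er]]]] := pseudo_division qB q0 p2B.
have rw : lead_coef q ^+ s * d ^+ N = x * r.[w].
  have -> : r.[w] = lead_coef q ^+ s * p2.[w].
    by rewrite -hornerZ Er hornerD hornerM qw mulr0 add0r.
  by rewrite -p2E dE exprMn E; ring.
(* The difference vanishes at w and has degree below the minimal one. *)
have /(congr1 (fun p : {poly A} => p`_0)) :
    (lead_coef q ^+ s * d ^+ N)%:P - x *: r = 0.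
  apply: q_min.
  - by rewrite rpredB ?polyOverC ?polyOverZ // rpredM ?rpredX.
  - by rewrite hornerD hornerN hornerZ hornerC rw subrr.
  - apply: leq_ltn_trans (size_polyD _ _) _; rewrite size_polyN gtn_max.
    rewrite (leq_ltn_trans (size_polyC_leq1 _) size_min_annihilator).
    by rewrite (leq_ltn_trans (size_scale_leq _ _)).
rewrite coefB coefC coefZ coef0 eqxx => /subr0_eq rE.
exists (s + N)%N, (lead_coef q ^+ N * d ^+ s * r`_0).
  by rewrite rpredM ?rpredM ?rpredX //; apply/polyOverP.
transitivity (lead_coef q ^+ N * d ^+ s * (lead_coef q ^+ s * d ^+ N)).
  by rewrite exprMn !exprD mulrACA [lead_coef q ^+ s * _]mulrC mulrACA; ring.
by rewrite rE; ring.
Qed.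

End Algebraic.

Lemma descend_adjoin : power_divisors_descend B (adjoin B w).
Proof.
pose annihilates (p : {poly A}) := [/\ p \is a polyOver B, p != 0 & p.[w] = 0].
have [[p pP]|noP] := EM (exists p, annihilates p); last first.
  apply: descend_transcendental => p pB pw; apply/eqP/negPn/negP => p0.
  by apply: noP; exists p.
have exn : exists n, `[< exists2 p, annihilates p & size p = n >].
  by exists (size p); apply/asboolP; exists p.
case: (ex_minnP exn) => n /asboolP[q [qB q0 qw] qn] nmin.
apply: (@descend_algebraic q) => // r rB rw rq; apply/eqP/negPn/negP => r0.
move: rq; rewrite qn ltnNge => /negP; apply; apply: nmin.
by apply/asboolP; exists r.
Qed.

End OneElement.

Lemma descend_adjoin_seq (B : subringClosed A) s :
  power_divisors_descend B (adjoin_seq B s).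
Proof.
elim: s => [|w s IHs] /=; first by move=> b bB b0; exists b.
apply: power_divisors_descend_trans IHs _; first exact: sub_adjoin_seq.
exact: descend_adjoin.
Qed.

End Adjunction.

(** * Orbits spanning a finite-dimensional space *)

Section FiniteOrbit.
Variables (k : fieldType) (V : lmodType k).

(** Among [n + 1] iterates in a space of dimension [n] there is a relation: a
    vector of the kernel of their coordinate matrix. *)
Lemma finite_orbit_relation (D : V -> V) (v : V) :
  finite_dimensional (lin_span (fun x => exists m, x = iter m D v)) ->
  exists2 p : {poly k}, p != 0 & \sum_(i < size p) p`_i *: iter i D v = 0.
Proof.
move=> [n [b [_ b_span]]].
have in_span (i : nat) : exists c : 'I_n -> k,
    iter i D v = \sum_(j < n) c j *: b j.
  apply/b_span; exists 1%N, (fun=> iter i D v), (fun=> 1).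
  by split=> [_|]; [exists i | rewrite big_ord1 scale1r].
have [f fE] := choice in_span.
pose M := \matrix_(i < n.+1, j < n) f i j.
have : kermx M != 0.
  by rewrite kermx_eq0 /row_free neq_ltn ltnS rank_leq_col.
case/rowV0Pn => u /sub_kermxP uM u0; exists (rVpoly u).
  by apply: contraNneq u0 => p0; rewrite -(rVpolyK u) p0 linear0.
rewrite (big_ord_widen n.+1 (fun i => (rVpoly u)`_i *: iter i D v)) ?size_poly //.
rewrite big_mkcond /=.
transitivity (\sum_(i < n.+1) \sum_(j < n) (u 0 i * M i j) *: b j).
  apply: eq_bigr => i _; rewrite -coef_rVpoly_ord; case: ifP => [_|/negbT ip].
    by rewrite fE scaler_sumr; apply: eq_bigr => j _; rewrite mxE scalerA.
  rewrite nth_default 1?leqNgt //.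
  by rewrite big1 // => j _; rewrite mul0r scale0r.
rewrite exchange_big big1 //= => j _; rewrite -scaler_suml.
have /(congr1 (fun N : 'rV_n => N 0 j)) := uM.
by rewrite !mxE => ->; rewrite scale0r.
Qed.

End FiniteOrbit.

(** * Derivations *)

Section Derivation.
Variables (k : fieldType) (A : comAlgType k) (D : {linear A -> A}).
Hypothesis D_derivation : is_derivation D.

Lemma derivation1 : D 1 = 0.
Proof.
have /esym/eqP := D_derivation 1 1.
by rewrite !mulr1 mul1r -subr_eq0 addrK => /eqP.
Qed.

Lemma derivation_const c : D c%:A = 0.
Proof. by rewrite linearZ /= derivation1 scaler0. Qed.

Lemma derivationX (x : A) n : D (x ^+ n.+1) = n.+1%:R * x ^+ n * D x.
Proof.
elim: n => [|n IHn]; first by rewrite expr1 mul1r mul1r.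
by rewrite exprS D_derivation IHn exprS -[n.+2%:R]natr1; ring.
Qed.

Lemma horner_algXaddC (a : A) (p : {poly k}) c :
  horner_alg a (p * 'X + c%:P) = horner_alg a p * a + c%:A.
Proof. by rewrite rmorphD rmorphM /= horner_algX horner_algC. Qed.

Lemma derivation_horner (a : A) (p : {poly k}) :
  D (horner_alg a p) = horner_alg a p^`() * D a.
Proof.
elim/poly_ind: p => [|p c IHp]; first by rewrite deriv0 !rmorph0 linear0 mul0r.
rewrite horner_algXaddC linearD derivation_const addr0 D_derivation IHp.
rewrite derivD derivM derivC derivX addr0 mulr1 rmorphD rmorphM /= horner_algX.
by ring.
Qed.

Section UnitRecurrence.
Variables (S : subringClosed A) (u v : A).
Hypotheses (SD : {in S, forall x, D x \in S}) (uS : u \in S) (uv : u * v = 1).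

(** The leading term in the pole of [D^n(1/u)] along [u = 0]. *)
Lemma iter_derivation_inverse n : exists2 r, r \in S &
  u ^+ n.+1 * iter n D v = (-1) ^+ n * n`!%:R * D u ^+ n + u * r.
Proof.
elim: n => [|n [r rS E]]; first by exists 0; rewrite ?rpred0 //= !mul1r mulr0 addr0.
set R := (-1) ^+ n * n`!%:R * D u ^+ n + u * r in E.
have RS : R \in S.
  by rewrite rpredD ?rpredM ?rpredX ?rpred_nat ?rpredN1 // SD.
exists (D R - n.+1%:R * D u * r).
  by rewrite rpredB ?SD // rpredM // rpredM ?rpred_nat ?SD.
have := D_derivation (u ^+ n.+1) (iter n D v).
rewrite E derivationX => DR.
have -> : u ^+ n.+2 * iter n.+1 D v =
    u * D R - n.+1%:R * D u * (u ^+ n.+1 * iter n D v).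
  by rewrite DR iterS [u ^+ n.+2]exprS exprS; ring.
by rewrite E /R factS natrM [(-1) ^+ n.+1]exprS [D u ^+ n.+1]exprS; ring.
Qed.

Hypothesis k_char0 : [pchar k] =i pred0.
Hypothesis S_scal : forall (c : k) x, x \in S -> c *: x \in S.
Hypothesis v_finite :
  finite_dimensional (lin_span (fun x => exists m, x = iter m D v)).

(** In a linear relation between the iterates of [D] on [1/u], only the highest
    one has a pole of maximal order, so its polar coefficient, a nonzero scalar
    times [D u ^+ N], must vanish modulo [u]. *)
Lemma unit_divides_power_derivative : divides_power_in S u (D u).
Proof.
have [p p0 rel] := finite_orbit_relation v_finite.
have p_gt0 : (0 < size p)%N by rewrite size_poly_gt0.
have lp0 : p`_(size p).-1 != 0 by rewrite -lead_coefE lead_coef_eq0.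
move: p_gt0 lp0 rel; case: (size p) => // N _ /=.
rewrite big_ord_recr /=; set c := p`_N => c0 rel.
have [r rS Er] := iter_derivation_inverse N.
(* The terms of order below N carry a spare factor u. *)
have [y yS Ey] : exists2 y, y \in S &
    u ^+ N.+1 * (\sum_(i < N) p`_i *: iter i D v) = u * y.
  exists (\sum_(i < N) p`_i *: (u ^+ (N - i.+1) * (u ^+ i.+1 * iter i D v))).
    apply: rpred_sum => i _; apply: S_scal; rewrite rpredM ?rpredX //.
    have [s sS ->] := iter_derivation_inverse i.
    by rewrite rpredD ?rpredM ?rpredX ?rpred_nat ?rpredN1 // SD.
  rewrite !mulr_sumr; apply: eq_bigr => i _.
  by rewrite -!scalerAr mulrA -exprD subnK // mulrA -exprS.
have e0 : c * ((-1) ^+ N * N`!%:R) != 0.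
  by rewrite !mulf_neq0 ?signr_eq0 // (pcharf0P k).1 // -lt0n fact_gt0.
set e := c * _ in e0.
have Ee : e *: D u ^+ N = u * (- y - c *: r).
  move/(congr1 (fun z => u ^+ N.+1 * z)): rel.
  rewrite mulr0 mulrDr Ey -scalerAr Er scalerDr => /eqP.
  rewrite addrC -addrA addr_eq0 => /eqP Ed.
  rewrite /e -scalerA.
  have -> : ((-1) ^+ N * N`!%:R) *: D u ^+ N = (-1) ^+ N * N`!%:R * D u ^+ N.
    by rewrite -mulr_algl -[_%:A]/(in_alg A _) rmorphM rmorph_sign rmorph_nat.
  by rewrite Ed mulrBr mulrN -scalerAr opprD addrC.
exists N, (e^-1 *: (- y - c *: r)).
  by rewrite S_scal // rpredB ?rpredN // S_scal.
by rewrite -scalerAr -Ee scalerA mulVf ?scale1r.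
Qed.

End UnitRecurrence.

Definition poly_values (a : A) : {pred A} :=
  fun x => `[< exists p : {poly k}, x = horner_alg a p >].

Lemma poly_valuesP a x :
  reflect (exists p : {poly k}, x = horner_alg a p) (x \in poly_values a).
Proof. by rewrite unfold_in; apply: asboolP. Qed.

Lemma poly_values_subring a : GRing.subring_closed (poly_values a).
Proof.
split.
- by apply/poly_valuesP; exists 1; rewrite rmorph1.
- move=> x y /poly_valuesP[p ->] /poly_valuesP[q ->]; apply/poly_valuesP.
  by exists (p - q); rewrite rmorphB.
- move=> x y /poly_valuesP[p ->] /poly_valuesP[q ->]; apply/poly_valuesP.
  by exists (p * q); rewrite rmorphM.
Qed.

HB.instance Definition _ a :=
  GRing.isSubringClosed.Build A (poly_values a) (poly_values_subring a).

(** Intersecting with [S] makes this a subring, by the Leibniz rule; [S] is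
    stable under [D] as soon as this subring contains generators of [S]. *)
Definition D_preimage (S : {pred A}) : {pred A} :=
  fun x => (x \in S) && (D x \in S).

Lemma mem_D_preimage S x : (x \in D_preimage S) = (x \in S) && (D x \in S).
Proof. by []. Qed.

Lemma D_preimage_subring (S : subringClosed A) :
  GRing.subring_closed (D_preimage S).
Proof.
split=> [|x y|x y]; rewrite !mem_D_preimage.
- by rewrite rpred1 derivation1 rpred0.
- by move=> /andP[xS DxS] /andP[yS DyS]; rewrite linearB !rpredB.
- by move=> /andP[xS DxS] /andP[yS DyS]; rewrite D_derivation rpredD ?rpredM.
Qed.

HB.instance Definition _ (S : subringClosed A) :=
  GRing.isSubringClosed.Build A (D_preimage S) (D_preimage_subring S).

(** Adjoin to [k[a]] a basis of the span of the orbit: this span is stable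
    under [D], hence so is the ring that it generates. *)
Lemma finite_orbit_stable_subring (a : A) :
  finite_dimensional (lin_span (fun x => exists m, x = iter m D a)) ->
  exists s, let S := adjoin_seq (poly_values a) s in
    {in S, forall x, D x \in S} /\ forall (c : k) x, x \in S -> c *: x \in S.
Proof.
move=> [n [b [_ b_span]]]; exists (codom b) => /=.
set S := adjoin_seq _ _.
have scal_S (c : k) x : x \in S -> c *: x \in S.
  move=> xS; rewrite -[x]mul1r scalerAl rpredM //; apply: sub_adjoin_seq.
  by apply/poly_valuesP; exists c%:P; rewrite horner_algC.
have bS j : b j \in S by apply/adjoin_seq_gen/codom_f.
have span_S x : (exists c : 'I_n -> k, x = \sum_(i < n) c i *: b i) -> x \in S.
  by move=> [c ->]; apply: rpred_sum => i _; apply: scal_S.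
have orbit_S m : iter m D a \in S.
  apply/span_S/b_span; exists 1%N, (fun=> iter m D a), (fun=> 1).
  by split=> [_|]; [exists m | rewrite big_ord1 scale1r].
have DbS j : D (b j) \in S.
  have /b_span[m [v [c [vP ->]]]] : exists c, b j = \sum_(i < n) c i *: b i.
    exists (fun i => (i == j)%:R).
    rewrite (bigD1 j) //= eqxx scale1r big1 ?addr0 // => i /negPf ->.
    by rewrite scale0r.
  rewrite linear_sum rpred_sum // => i _; rewrite linearZ scal_S //.
  by have [l ->] := vP i; rewrite -iterS.
have aS : a \in S by apply: (orbit_S 0).
split=> // x xS.
suff : x \in D_preimage S by rewrite mem_D_preimage => /andP[].
apply: (@adjoin_seq_least A (poly_values a) (codom b) (D_preimage S)) xS.
  move=> _ /poly_valuesP[p ->]; rewrite mem_D_preimage derivation_horner.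
  have pS q : horner_alg a q \in S.
    by apply/sub_adjoin_seq/poly_valuesP; exists q.
  by rewrite pS rpredM // (orbit_S 1).
by move=> _ /codomP[j ->]; rewrite mem_D_preimage bS DbS.
Qed.

Hypothesis domA : GRing.integral_domain_axiom A.
Hypothesis k_char0 : [pchar k] =i pred0.

(** Differentiating [p(a) = 0] gives [p'(a) * D a = 0], where [p'] is nonzero of
    smaller degree in characteristic zero. *)
Lemma derivation_algebraic (a : A) (p : {poly k}) :
  p != 0 -> horner_alg a p = 0 -> D a = 0.
Proof.
have [n] := ubnP (size p); elim: n p => // n IHn p pn p0 pa.
have [p1|p_gt1] := leqP (size p) 1.
  move: p0 pa; rewrite (size1_polyC p1) horner_algC polyC_eq0 => c0 /eqP.
  by rewrite scaler_eq0 (negPf c0) oner_eq0.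
have dp0 : p^`() != 0.
  apply: contraTneq p_gt1 => dp0; rewrite -leqNgt; apply/leq_sizeP => -[//|j] _.
  move/(congr1 (fun q : {poly k} => q`_j)): dp0; rewrite coef_deriv coef0.
  by move/eqP; rewrite -mulr_natr mulf_eq0 (pcharf0P k).1 // orbF => /eqP.
have := derivation_horner a p.
rewrite pa linear0 => /esym/domA/orP[/eqP dpa|/eqP //].
by apply: IHn dp0 dpa; rewrite -ltnS (leq_trans _ pn) // ltnS lt_size_deriv.
Qed.

Lemma poly_root_everywhere (p : {poly k}) : (forall c, root p c) -> p = 0.
Proof.
move=> p_root; apply/eqP/negPn/negP => p0.
have := @max_poly_roots _ p [seq i%:R | i <- iota 0 (size p)] p0.
rewrite size_map size_iota ltnn => H; suff : false by [].
apply: H; first by apply/allP => x _.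
rewrite map_inj_uniq ?iota_uniq // => i j /eqP.
wlog ij : i j / (i <= j)%N.
  move=> W; case: (leqP i j) => [/W //|/ltnW/W H]; rewrite eq_sym => /H.
  by move=> ->.
rewrite eq_sym -subr_eq0 -natrB // (pcharf0P k).1 // subn_eq0 => ji.
by apply/eqP; rewrite eqn_leq ij ji.
Qed.

End Derivation.

(** * Locally finite derivations of local domains *)

Theorem proposition2p2 (k : fieldType) (A : comAlgType k)
    (k_char0 : [pchar k] =i pred0)
    (A_domain : GRing.integral_domain_axiom A)
    (D : {linear A -> A}) (D_derivation : is_derivation D)
    (A_local : local_ring A) (D_locally_finite : locally_finite D) :
  forall a : A, D a = 0.
Proof.
move=> a; apply/eqP/negPn/negP => Da0.
have a_trans (p : {poly k}) : horner_alg a p = 0 -> p = 0.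
  move=> pa; apply/eqP/negPn/negP => p0; move/eqP: Da0; apply.
  exact: derivation_algebraic p0 pa.
have [c0 unit_shift] : exists c0 : k, forall c, c != c0 ->
    exists v, (a - c%:A) * v = 1.
  have [[c0 c0_nonunit]|no_c0] :=
      EM (exists c0 : k, forall v, (a - c0%:A) * v != 1); last first.
    exists 0 => c _; apply: contrapT => c_nonunit; apply: no_c0; exists c => v.
    by apply/eqP => E; apply: c_nonunit; exists v.
  exists c0 => c c_neq; apply: contrapT => c_nonunit.
  have nonunit v : (a - c%:A) * v != 1.
    by apply/eqP => E; apply: c_nonunit; exists v.
  (* The difference of the two shifts is a nonzero scalar. *)
  have := local_ring_nonunit_sub A_local nonunit c0_nonunit ((c0 - c)^-1)%:A.
  have -> : a - c%:A - (a - c0%:A) = (c0 - c)%:A by rewrite scalerBl; ring.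
  by rewrite mulr_algl scalerA divff ?scale1r ?eqxx // subr_eq0 eq_sym.
have [s [SD S_scal]] := finite_orbit_stable_subring D_derivation (D_locally_finite a).
set S := adjoin_seq _ s in SD S_scal.
have polyS p : horner_alg a p \in S.
  by apply/sub_adjoin_seq/poly_valuesP; exists p.
have aS : a \in S by rewrite -(horner_algX a) polyS.
have [_ [/poly_valuesP[g ->] ga0 g_div]] :=
  descend_adjoin_seq A_domain (SD a aS) Da0.
(* The factor makes every scalar a root, including the exceptional c0. *)
have : g * ('X - c0%:P) == 0.
  apply/eqP/(poly_root_everywhere k_char0) => c; rewrite rootM root_XsubC.
  have [->|c_neq] := eqVneq c c0; first by rewrite orbT.
  rewrite orbF; have [v uv] := unit_shift c c_neq.
  have uE : a - c%:A = horner_alg a ('X - c%:P).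
    by rewrite rmorphB /= horner_algX horner_algC.
  have Du : D (a - c%:A) = D a by rewrite linearB derivation_const // subr0.
  have uS : a - c%:A \in S by rewrite uE polyS.
  have := unit_divides_power_derivative D_derivation SD uS uv k_char0 S_scal
    (D_locally_finite v).
  rewrite Du => /g_div[]; first by apply/poly_valuesP; exists ('X - c%:P).
  move=> N [_ /poly_valuesP[h ->]].
  rewrite uE -rmorphXn -rmorphM => /eqP; rewrite -subr_eq0 -rmorphB => /eqP.
  move=> /a_trans/subr0_eq gN.
  have : root (g ^+ N) c by rewrite gN rootM root_XsubC eqxx.
  by rewrite /root horner_exp expf_eq0 => /andP[].
rewrite mulf_eq0 polyXsubC_eq0 orbF => /eqP g0.
by rewrite g0 rmorph0 eqxx in ga0.
Qed.
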